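(* Let $k$ be a kernel on $\mathbb{R}^d$ with reproducing kernel Hilbert space $\mathcal{H}$, let $\mathcal{X}\subset\mathbb{R}^d$ be compact, and suppose that $k$ is continuous on $\mathbb{R}^d\times\mathbb{R}^d$ with $k(x_1,x_2)\le 1$ for all $x_1,x_2\in\mathcal{X}$. For $R>0$ let $S=\{f\in\mathcal{H}:\|f\|_{\mathcal{H}}\le R\}$. If there exists a deterministic algorithm that achieves simple regret $r_{(T)}\le\epsilon$ for every function $f\in S$ in $T$ function evaluations for the problem $\min_{x\in\mathcal{X}}f(x)$, then it is necessary that $$T=\Omega\left(\frac{\log\mathcal{N}(S(\mathcal{X}),4\epsilon,\|\cdot\|_\infty)}{\log(R/\epsilon)}\right).$$ Explicitly: there exist constants $c>0$ and $\eta_0\in(0,1)$, which may depend on $d$, $k$ and $\mathcal{X}$ but not on $R$, $\epsilon$, $T$ or the algorithm, such that for all $R>0$ and $\epsilon>0$ with $\epsilon/R<\eta_0$ and all positive integers $T$, the existence of a deterministic algorithm with $r_{(T)}\le\epsilon$ for all $f\in S$ implies $$T\ \ge\ c\,\frac{\log\mathcal{N}(S(\mathcal{X}),4\epsilon,\|\cdot\|_\infty)}{\log(R/\epsilon)}.$$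
   Context: Kernels are real-valued, symmetric and positive semidefinite; $\mathcal{H}$ is the RKHS of functions $\mathbb{R}^d\to\mathbb{R}$ with reproducing kernel $k:\mathbb{R}^d\times\mathbb{R}^d\to\mathbb{R}$ and norm $\|\cdot\|_{\mathcal{H}}$. Restriction: for $Q\subset\mathcal{H}$, $Q(\mathcal{X})=\{f|_{\mathcal{X}}: f\in Q\}$, viewed as a subset of the space $C(\mathcal{X})$ of continuous real functions on $\mathcal{X}$ with the sup norm $\|\cdot\|_\infty$. Covering number: for a subset $G$ of a normed space $(V,\|\cdot\|)$ and $\epsilon>0$, an $\epsilon$-covering of $G$ is a finite set $\{v_1,\dots,v_N\}\subset V$ such that $G\subset\bigcup_{i}\{v\in V:\|v-v_i\|\le\epsilon\}$; $\mathcal{N}(G,\epsilon,\|\cdot\|)$ is the smallest cardinality of an $\epsilon$-covering of $G$. For $S(\mathcal{X})$ the ambient space is $C(\mathcal{X})$ with the sup norm. Deterministic algorithm: a sequence of mappings $(\pi_t)_{t\ge1}$ with $\pi_1:\{\emptyset\}\to\mathcal{X}$ and $\pi_t:(\mathcal{X}\times\mathbb{R})^{t-1}\to\mathcal{X}$ for $t\ge2$. Run on $f$, it evaluates $f$ (noiselessly) at $x_1=\pi_1(\emptyset)$ and $x_t=\pi_t\big((x_\tau,f(x_\tau))_{\tau=1}^{t-1}\big)$ for $t\ge2$. Simple regret after $t$ evaluations: $r_{(t)}=\min_{1\le\tau\le t}f(x_\tau)-\min_{x\in\mathcal{X}}f(x)$. $\log$ is the natural logarithm. *)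

(* Defs.v *)
From HB Require Import structures.
From mathcomp Require Import all_boot all_order all_algebra.
From mathcomp Require Import all_classical all_reals all_analysis.

Set Implicit Arguments.
Unset Strict Implicit.
Unset Printing Implicit Defensive.

Import Order.TTheory GRing.Theory Num.Theory.
Import numFieldNormedType.Exports.

Local Open Scope classical_set_scope.
Local Open Scope ring_scope.

Section RKHS.
Context {R : realType} {E : Type}.
Implicit Types (k : E -> E -> R) (H : set (E -> R)) (f g : E -> R).

Record psd_kernel k : Prop := PsdKernel {
  kernel_sym : forall x y, k x y = k y x;
  kernel_psd : forall (n : nat) (x : 'I_n -> E) (a : 'I_n -> R),
    0 <= \sum_(i < n) \sum_(j < n) a i * a j * k (x i) (x j) }.

Definition ip_norm (ip : (E -> R) -> (E -> R) -> R) f : R :=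
  Num.sqrt (ip f f).

(* [ip] is a total function, but it is meaningful (and constrained) only on
   the carrier [H]. By Moore-Aronszajn, [k] determines [H] and [ip] on [H]. *)
Record is_rkhs k H (ip : (E -> R) -> (E -> R) -> R) : Prop := IsRkhs {
  rkhs_zero : H 0;
  rkhs_lin : forall (a : R) f g, H f -> H g -> H (a *: f + g);
  ip_sym : forall f g, H f -> H g -> ip f g = ip g f;
  ip_lin : forall (a : R) f g h, H f -> H g -> H h ->
    ip (a *: f + g) h = a * ip f h + ip g h;
  ip_ge0 : forall f, H f -> 0 <= ip f f;
  ip_definite : forall f, H f -> ip f f = 0 -> f = 0;
  rkhs_complete : forall u : nat -> E -> R, (forall n, H (u n)) ->
    (forall e : R, 0 < e -> exists N : nat, forall m n : nat,
       (N <= m)%N -> (N <= n)%N -> ip_norm ip (u m - u n) < e) ->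
    exists2 f, H f & ip_norm ip (u n - f) @[n --> \oo] --> (0 : R);
  rkhs_kernel : forall x, H (k x);
  rkhs_reproducing : forall f x, H f -> f x = ip f (k x) }.

Definition rkhs_ball H (ip : (E -> R) -> (E -> R) -> R) (r : R) :
    set (E -> R) :=
  [set f | H f /\ ip_norm ip f <= r].

End RKHS.

Section Covering.
Context {R : realType}.

(* The ambient normed space is a subspace [V] of [F], with norm [nrm] on [V]. *)
Definition is_covering (F : zmodType) (V : set F) (nrm : F -> R)
    (G : set F) (e : R) (C : set F) : Prop :=
  C `<=` V /\ G `<=` \bigcup_(c in C) [set v | V v /\ nrm (v - c) <= e].

(* Equals [+oo] when there is no finite covering. *)
Definition covering_number (F : zmodType) (V : set F) (nrm : F -> R)
    (G : set F) (e : R) : \bar R :=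
  ereal_inf [set (N%:R)%:E | N in
    [set N : nat | exists2 C : set F,
       is_covering V nrm G e C & (C #= `I_N)%card]].

Definition sup_norm (T : Type) (g : T -> R) : R :=
  sup (range (fun x => `|g x|)).

Definition continuous_functions (T : topologicalType) : set (T -> R) :=
  [set g : T -> R | continuous g].
Arguments continuous_functions T _ : clear implicits.

(* [X] as a type carries the subspace topology. *)
Definition restrictions (E : topologicalType) (X : set E) (Q : set (E -> R)) :
    set (X -> R) :=
  sigL X @` Q.
Arguments restrictions {E} X Q _.

Definition unif_covering_number (E : topologicalType) (X : set E)
    (Q : set (E -> R)) (e : R) : \bar R :=
  covering_number (continuous_functions X) (@sup_norm X)
    (restrictions X Q) e.

End Covering.

Section Algorithm.
Context {R : realType} {E : Type} (X : set E).

(* The index is the number of past evaluations: the map at index [t] chooses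
   evaluation number [t.+1]. *)
Definition algorithm : Type := forall t : nat, t.-tuple (X * R) -> X.

Fixpoint history (A : algorithm) (f : E -> R) (t : nat) : t.-tuple (X * R) :=
  match t with
  | 0 => [tuple]
  | s.+1 => let h := history A f s in
            [tuple of rcons h (A s h, f (val (A s h)))]
  end.

(* Queries are numbered from 0. *)
Definition query (A : algorithm) (f : E -> R) (t : nat) : E :=
  val (A t (history A f t)).

(* Only meaningful for [0 < T]; for such [T] the default value of the big
   minimum is one of its terms. *)
Definition simple_regret (A : algorithm) (f : E -> R) (T : nat) : R :=
  \big[Order.min/f (query A f 0)]_(t < T) f (query A f t) - inf (f @` X).

End Algorithm.

(* Main.v *)
Require Import Defs.
From HB Require Import structures.
From mathcomp Require Import all_boot all_order all_algebra.
From mathcomp Require Import all_classical all_reals all_analysis.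
From mathcomp Require Import ring lra.
Import Order.TTheory GRing.Theory Num.Theory.
Import numFieldNormedType.Exports.
Local Open Scope classical_set_scope.
Local Open Scope ring_scope.

(** Run the algorithm on the zero function; it queries x_1, ..., x_T. On any f
    in S vanishing at these points the algorithm behaves in the same way, so the
    regret bound gives f >= -eps on X, and, applied to -f, |f| <= eps on X.
    Every f in S is the sum of such a function and of its orthogonal projection
    onto the span of the k(x_t), a ball of radius R in dimension at most T.
    Rounding the coordinates of the projection, in an orthonormal system, to
    multiples of eps / sqrt T moves it by at most eps in the H-norm, hence in
    the sup norm since k <= 1 on the diagonal. This covers S(X) at scale 2 eps
    by the integer vectors z with |z|^2 <= M T, where M is about (R/eps)^2; as
    |z_i| <= z_i^2 these satisfy |z|_1 <= M T, and a weighted count bounds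
    their number by (2e(M+1))^T <= (R/eps)^(4T). *)

Set Implicit Arguments.
Unset Strict Implicit.
Unset Printing Implicit Defensive.

(** * Inner-product algebra and orthogonal projection in the RKHS *)

Section InnerProduct.
Context {R : realType} {E : Type}.
Context (k : E -> E -> R) (H : set (E -> R)).
Context (ip : (E -> R) -> (E -> R) -> R) (hH : is_rkhs k H ip).
Implicit Types (f g h : E -> R) (a b : R).

Lemma rkhsZ a f : H f -> H (a *: f).
Proof.
by move=> Hf; have := rkhs_lin hH a Hf (rkhs_zero hH); rewrite addr0.
Qed.

Lemma rkhsD f g : H f -> H g -> H (f + g).
Proof. by move=> Hf Hg; have := rkhs_lin hH 1 Hf Hg; rewrite scale1r. Qed.

Lemma rkhsN f : H f -> H (- f).
Proof. by move=> Hf; rewrite -scaleN1r; exact: rkhsZ. Qed.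

Lemma rkhsB f g : H f -> H g -> H (f - g).
Proof. by move=> Hf Hg; apply: rkhsD => //; exact: rkhsN. Qed.

Lemma rkhs_sum (I : finType) (F : I -> E -> R) :
  (forall i, H (F i)) -> H (\sum_i F i).
Proof.
move=> HF; elim/big_ind : _ => //; [exact: rkhs_zero hH|exact: rkhsD].
Qed.

Lemma ipDl f g h : H f -> H g -> H h -> ip (f + g) h = ip f h + ip g h.
Proof.
by move=> Hf Hg Hh; have := ip_lin hH 1 Hf Hg Hh; rewrite scale1r mul1r.
Qed.

Lemma ip0l h : H h -> ip 0 h = 0.
Proof.
move=> Hh; have H0 := rkhs_zero hH.
by apply: (@addrI _ (ip 0 h)); rewrite -ipDl// !addr0.
Qed.

Lemma ipZl a f h : H f -> H h -> ip (a *: f) h = a * ip f h.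
Proof.
move=> Hf Hh; have := ip_lin hH a Hf (rkhs_zero hH) Hh.
by rewrite addr0 ip0l// addr0.
Qed.

Lemma ipBl f g h : H f -> H g -> H h -> ip (f - g) h = ip f h - ip g h.
Proof.
move=> Hf Hg Hh; rewrite ipDl//; last exact: rkhsN.
by rewrite -scaleN1r ipZl// mulN1r.
Qed.

Lemma ipBr f g h : H f -> H g -> H h -> ip h (f - g) = ip h f - ip h g.
Proof.
move=> Hf Hg Hh; rewrite !(ip_sym hH Hh)//; last exact: rkhsB.
exact: ipBl.
Qed.

Lemma ipZr a f h : H f -> H h -> ip h (a *: f) = a * ip h f.
Proof.
move=> Hf Hh; rewrite !(ip_sym hH Hh)//; last exact: rkhsZ.
exact: ipZl.
Qed.

Lemma ip_suml (I : finType) (F : I -> E -> R) h :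
  (forall i, H (F i)) -> H h -> ip (\sum_i F i) h = \sum_i ip (F i) h.
Proof.
move=> HF Hh; suff [] : H (\sum_i F i) /\ ip (\sum_i F i) h = \sum_i ip (F i) h.
  by [].
elim/big_ind2 : _ => [|f a g b [Hf <-] [Hg <-]|i _].
- by split; [exact: rkhs_zero hH|rewrite ip0l].
- by split; [exact: rkhsD|rewrite ipDl].
- by split.
Qed.

Lemma cauchy_schwarz f g : H f -> H g -> ip f g ^+ 2 <= ip f f * ip g g.
Proof.
move=> Hf Hg; have [gg0|gg0] := eqVneq (ip g g) 0.
  by rewrite (ip_definite hH Hg gg0) (ip_sym hH Hf) ?ip0l ?expr0n ?mulr0//;
    exact: rkhs_zero hH.
have gg : 0 < ip g g by rewrite lt_def gg0 (ip_ge0 hH).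
(* This [t] minimises the squared norm of [f - t *: g], whose nonnegativity is then the claim. *)
set t := ip f g / ip g g.
have Htg : H (t *: g) by exact: rkhsZ.
have := ip_ge0 hH (rkhsB Hf Htg).
rewrite ipBl ?ipBr ?ipZl ?ipZr//; last exact: rkhsB.
rewrite (ip_sym hH Hg Hf) -[ip f g ^+ 2 <= _]subr_ge0.
have -> : ip f f - t * ip f g - (t * ip f g - t * (t * ip g g)) =
  (ip f f * ip g g - ip f g ^+ 2) / ip g g by rewrite /t; field.
by rewrite pmulr_lge0 ?invr_gt0.
Qed.

Lemma rkhs_eval_le f x : H f -> f x ^+ 2 <= ip f f * k x x.
Proof.
move=> Hf; have Hk := rkhs_kernel hH x.
rewrite {1}(rkhs_reproducing hH x Hf) (rkhs_reproducing hH x Hk).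
exact: cauchy_schwarz.
Qed.

Lemma rkhs_eval_abs_le f x a : 0 <= a -> k x x <= 1 -> H f ->
  ip f f <= a ^+ 2 -> `|f x| <= a.
Proof.
move=> a0 kx Hf fa; rewrite -(@ler_pXn2r _ 2) ?nnegrE// real_normK ?num_real//.
apply: le_trans (rkhs_eval_le x Hf) (le_trans _ fa).
by rewrite ler_piMr// (ip_ge0 hH).
Qed.

Lemma rkhs_ballP f a : 0 <= a -> rkhs_ball H ip a f <-> H f /\ ip f f <= a ^+ 2.
Proof.
move=> a0; rewrite /rkhs_ball/= /ip_norm; split=> -[Hf fa]; split=> //.
  by rewrite -(sqr_sqrtr (ip_ge0 hH Hf)) ler_pXn2r ?nnegrE ?sqrtr_ge0.
by rewrite -(ger0_norm a0) -sqrtr_sqr; exact: ler_wsqrtr.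
Qed.

(* Dependent vectors are kept as zero entries rather than discarded, so that
   the family stays indexed by the original index set. *)
Definition orthosystem (n : nat) (e : 'I_n -> E -> R) :=
  [/\ forall i, H (e i),
      forall i j, i != j -> ip (e i) (e j) = 0
    & forall i, ip (e i) (e i) = 1 \/ e i = 0].

Section Orthosystem.
Context (n : nat) (e : 'I_n -> E -> R) (he : orthosystem e).

Definition orthoproj f := \sum_i ip f (e i) *: e i.

Lemma rkhs_comb (c : 'I_n -> R) : H (\sum_i c i *: e i).
Proof. by case: he => He _ _; apply: rkhs_sum => i; exact: rkhsZ. Qed.

Lemma ip_comb_basis (c : 'I_n -> R) j :
  ip (\sum_i c i *: e i) (e j) = c j * ip (e j) (e j).
Proof.
case: he => He oe _; rewrite ip_suml//; last by move=> i; exact: rkhsZ.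
rewrite (bigD1 j)//= ipZl// big1 ?addr0// => i ij.
by rewrite ipZl// oe// mulr0.
Qed.

(** Equality can fail: a zero entry [e i] loses its coefficient on the left side. *)
Lemma ip_comb_le (c : 'I_n -> R) :
  ip (\sum_i c i *: e i) (\sum_i c i *: e i) <= \sum_i c i ^+ 2.
Proof.
have Hc := rkhs_comb c.
case: (he) => He _ ne; rewrite {1}ip_suml//; last by move=> i; exact: rkhsZ.
apply: ler_sum => i _; rewrite ipZl// (ip_sym hH (He i))// ip_comb_basis.
case: (ne i) => [->|->]; first by rewrite mulr1.
by rewrite ip0l ?mulr0 ?sqr_ge0//; exact: rkhs_zero hH.
Qed.

Lemma orthoproj_residual f i : H f -> ip (f - orthoproj f) (e i) = 0.
Proof.
case: (he) => He _ ne Hf; rewrite ipBl//; last exact: rkhs_comb.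
rewrite ip_comb_basis; case: (ne i) => ei; first by rewrite ei mulr1 subrr.
rewrite ei (ip_sym hH Hf) ?ip0l ?mul0r ?subrr//; exact: rkhs_zero hH.
Qed.

(** Serves two bounds: the residual stays in the ball of [f], and so does the coefficient vector. *)
Lemma orthoproj_pythagoras f : H f ->
  ip f f = ip (f - orthoproj f) (f - orthoproj f) + \sum_i ip f (e i) ^+ 2.
Proof.
move=> Hf; case: (he) => He _ ne; have HP := rkhs_comb (fun i => ip f (e i)).
have Hg := rkhsB Hf HP.
rewrite [in RHS]ipBr// [X in _ = _ - X + _](ip_sym hH Hg HP).
rewrite [X in _ = _ - X + _]ip_suml//; last by move=> i; exact: rkhsZ.
rewrite [X in _ = _ - X + _]big1 ?subr0; last first.
  by move=> i _; rewrite ipZl// (ip_sym hH (He i))// orthoproj_residual ?mulr0.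
rewrite ipBl// ip_suml//; last by move=> i; exact: rkhsZ.
rewrite -[LHS](subrK (\sum_i ip f (e i) ^+ 2)); congr (_ - _ + _).
by apply: eq_bigr => i _; rewrite ipZl// expr2 (ip_sym hH Hf).
Qed.

End Orthosystem.

(** The span of [v] matters only through its orthogonal complement: with kernel sections for [v],
    orthogonality means vanishing at the points. *)
Lemma gram_schmidt (n : nat) (v : nat -> E -> R) : (forall i, H (v i)) ->
  exists2 e : 'I_n -> E -> R, orthosystem e &
    forall f, H f -> (forall i, ip f (e i) = 0) ->
      forall i, (i < n)%N -> ip f (v i) = 0.
Proof.
move=> Hv; elim: n => [|n [e he espan]].
  by exists (fun=> 0) => //; split=> // -[].
set h := v n - orthoproj e (v n).
have HP : H (orthoproj e (v n)) by exact: rkhs_comb.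
have Hh : H h by exact: rkhsB.
(* Normalises [h]; if [v n] depends on the earlier vectors, [h = 0] and the new entry is zero. *)
set c := (Num.sqrt (ip h h))^-1.
pose e' (i : 'I_n.+1) := if unlift ord_max i is Some j then e j else c *: h.
have e'L (j : 'I_n) : e' (lift ord_max j) = e j by rewrite /e' liftK.
have e'M : e' ord_max = c *: h by rewrite /e' unlift_none.
case: (he) => He oe ne.
have Hch : H (c *: h) by exact: rkhsZ.
have he0 i : ip h (e i) = 0 by exact: orthoproj_residual.
exists e'; first split.
- by move=> i; case: (unliftP ord_max i) => [j|] ->; rewrite ?e'L ?e'M.
- move=> i j; case: (unliftP ord_max i) => [i'|] ->;
    case: (unliftP ord_max j) => [j'|] ->; rewrite ?e'L ?e'M ?eqxx//.
  + by rewrite (inj_eq lift_inj); exact: oe.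
  + by rewrite ipZr// (ip_sym hH (He _))// he0 mulr0.
  + by rewrite ipZl// he0 mulr0.
- move=> i; case: (unliftP ord_max i) => [i'|] ->; rewrite ?e'L ?e'M//.
  have [hh0|hh0] := eqVneq (ip h h) 0.
    by right; rewrite (ip_definite hH Hh hh0) scaler0.
  left; rewrite ipZl// ipZr// mulrA -expr2 exprVn sqr_sqrtr ?mulVf//.
  by rewrite (ip_ge0 hH).
- move=> f Hf fe' i; have fe j : ip f (e j) = 0 by rewrite -e'L.
  rewrite ltnS leq_eqVlt => /predU1P[->|]; last exact: espan.
  have fh : ip f h = 0.
    have [hh0|hh0] := eqVneq (ip h h) 0.
      by rewrite (ip_definite hH Hh hh0) (ip_sym hH Hf) ?ip0l//;
        exact: rkhs_zero hH.
    have := fe' ord_max; rewrite e'M ipZr// => /eqP.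
    rewrite mulf_eq0 invr_eq0 sqrtr_eq0 => /orP[|/eqP//].
    by rewrite le_eqVlt (negbTE hh0)/= ltNge (ip_ge0 hH).
  have -> : v n = h + orthoproj e (v n) by rewrite /h subrK.
  rewrite (ip_sym hH Hf) ?(ipDl Hh HP Hf)//; last exact: rkhsD.
  rewrite (ip_sym hH Hh Hf) fh add0r ip_suml//; last by move=> j; exact: rkhsZ.
  by rewrite big1// => j _; rewrite ipZl// (ip_sym hH (He j) Hf) fe mulr0.
Qed.

End InnerProduct.

(** * Continuity of RKHS functions *)

Lemma rkhs_continuous (R : realType) (E : topologicalType) (k : E -> E -> R)
    (H : set (E -> R)) (ip : (E -> R) -> (E -> R) -> R) :
  is_rkhs k H ip -> continuous (fun p : E * E => k p.1 p.2) ->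
  forall f, H f -> continuous f.
Proof.
move=> hH kc f Hf x.
(* The squared norm of [f] times that of [k x - k y], the Cauchy-Schwarz bound for the square of
   [f x - f y]. *)
pose D y := ip f f * (k x x - k x y - (k y x - k y y)).
have fD y : `|f x - f y| ^+ 2 <= D y.
  have Hk := rkhs_kernel hH.
  rewrite real_normK ?num_real// /D.
  rewrite (rkhs_reproducing hH x Hf) (rkhs_reproducing hH y Hf).
  rewrite (rkhs_reproducing hH x (Hk x)) (rkhs_reproducing hH y (Hk x)).
  rewrite (rkhs_reproducing hH x (Hk y)) (rkhs_reproducing hH y (Hk y)).
  rewrite -(ipBr hH) // -!(ipBr hH (Hk x) (Hk y))//.
  rewrite -(ipBl hH (Hk x) (Hk y)); last exact: (rkhsB hH).
  by apply: (cauchy_schwarz hH) => //; exact: (rkhsB hH).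
have kcvg (u v : E -> E) : {for x, continuous u} -> {for x, continuous v} ->
    k (u y) (v y) @[y --> x] --> k (u x) (v x).
  move=> uc vc; apply: (@continuous_comp _ _ _ (fun y => (u y, v y))
    (fun p => k p.1 p.2)); last exact: kc.
  exact: cvg_pair.
have D0 : D y @[y --> x] --> (0 : R).
  have -> : 0 = D x by rewrite /D !subrr mulr0.
  apply: cvgMr; apply: cvgB; apply: cvgB.
  - exact: cvg_cst.
  - by apply: kcvg => //; exact: cvg_cst.
  - by apply: kcvg => //; exact: cvg_cst.
  - exact: kcvg.
apply/cvgrPdist_lt => e e0.
have e20 : 0 < e ^+ 2 by rewrite exprn_gt0.
move/cvgrPdist_lt: D0 => /(_ _ e20); apply: filterS => y.
rewrite sub0r normrN => /(le_lt_trans (ler_norm _)) Dy.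
by rewrite -(@ltr_pXn2r _ 2) ?nnegrE ?(ltW e0)// (le_lt_trans (fD y)).
Qed.

(** * Runs of an algorithm on functions that agree at its queries *)

Section Algorithm.
Context {R : realType} {E : Type} (X : set E) (A : @algorithm R E X).

Lemma eq_history (f g : E -> R) (t : nat) :
  (forall i, (i < t)%N -> f (query A g i) = g (query A g i)) ->
  history A f t = history A g t.
Proof.
elim: t => // t IH fg; apply/val_inj => /=.
rewrite IH; last by move=> i it; apply: fg; exact: ltnW.
by have := fg t (ltnSn t); rewrite /query => ->.
Qed.

Lemma eq_query (f g : E -> R) (t : nat) :
  (forall i, (i < t)%N -> f (query A g i) = g (query A g i)) ->
  query A f t = query A g t.
Proof. by move=> fg; rewrite /query (eq_history fg). Qed.

(** All observed values are 0, so the regret is minus the infimum of [f]. The bound [B] makes [inf]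
    a genuine lower bound. *)
Lemma simple_regret_vanish (f : E -> R) (T : nat) (x : E) (B eps : R) :
  X x -> (forall y, X y -> - B <= f y) -> (0 < T)%N ->
  (forall i, (i < T)%N -> f (query A 0 i) = 0) ->
  simple_regret A f T <= eps -> - eps <= f x.
Proof.
move=> Xx fB T0 f0.
have fq i : (i < T)%N -> f (query A f i) = 0.
  move=> iT; rewrite (@eq_query f 0) ?f0// => j ji.
  by rewrite f0//; exact: ltn_trans iT.
rewrite /simple_regret fq//.
(* The default of the minimum, the value at query 0, has already become 0. *)
have -> : \big[Order.min/0]_(t < T) f (query A f t) = 0 :> R.
  elim/big_ind : _ => // [a b -> ->|i _]; first by rewrite minxx.
  exact: fq.
rewrite sub0r lerNl => /le_trans; apply.
apply: ge_inf; last by exists x.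
by exists (- B) => _ [y Xy <-]; exact: fB.
Qed.

End Algorithm.

(** * Counting and rounding to integer vectors of bounded l1 norm *)

Section Counting.
Context {R : realType} (T M : nat).

(* Integer vectors, coded by a sign bit (so 0 has two codes) and an absolute
   value per coordinate. *)
Definition lattice : {set {ffun 'I_T -> bool * 'I_(M * T).+1}} :=
  finset (fun z : {ffun 'I_T -> bool * 'I_(M * T).+1} =>
    \sum_i (z i).2 <= M * T)%N.

(* Chernoff-type counting: the weight below is at least 1 on the lattice, and
   its sum over all sign-magnitude vectors factors over the coordinates. *)
Lemma card_lattice_le : (0 < M)%N ->
  #|lattice|%:R <= (2 * expR 1 * M.+1%:R) ^+ T :> R.
Proof.
move=> M0; have M0R : 0 < M%:R :> R by rewrite ltr0n.
(* Balances two factors: [a ^+ M] is at most [expR 1], and the geometric series in [a^-1] sums to at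
   most [M.+1]. *)
pose a : R := 1 + M%:R^-1; have a0 : 0 < a by rewrite addr_gt0 ?invr_gt0.
have a1 : a != 0 by rewrite gt_eqF.
(* Over all coordinates the weights multiply to [a] to the power [M * T] minus the l1 norm. *)
pose w (b : bool * 'I_(M * T).+1) : R := a ^+ M * a^-1 ^+ b.2.
have w0 b : 0 <= w b by rewrite mulr_ge0// exprn_ge0// ?invr_ge0 ltW.
have w1 z : z \in lattice -> 1 <= \prod_i w (z i).
  rewrite inE => zL; rewrite big_split/= prodr_const card_ord -exprM.
  rewrite (eq_bigr (fun i => a^-1 ^+ (z i).2))//.
  rewrite -(big_morph _ (exprD a^-1) (expr0 _)) exprVn.
  rewrite -{1}(mulfV (expf_neq0 (\sum_i (z i).2) a1)).
  rewrite ler_wpM2r ?invr_ge0 ?exprn_ge0 ?(ltW a0)//.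
  by rewrite ler_eXn2l// ltrDl invr_gt0.
have ws : \sum_b w b <= 2 * expR 1 * M.+1%:R.
  rewrite (eq_bigr (fun b : bool * 'I_(M * T).+1 => w (true, b.2)))//.
  rewrite -(pair_bigA _ (fun (_ : bool) j => w (true, j)))/=.
  rewrite sumr_const card_bool -[leLHS]mulr_natl -mulrA ler_wpM2l//.
  rewrite -mulr_sumr ler_pM ?exprn_ge0 ?(ltW a0)//.
  - by apply: sumr_ge0 => i _; rewrite exprn_ge0 ?invr_ge0 ?ltW.
  - rewrite -[in leRHS](@mulVf _ M%:R) ?gt_eqF// expRM_natr.
    by rewrite lerXn2r ?nnegrE ?(ltW a0) ?expR_ge0 ?expR_ge1Dx.
  - have q1 : 0 < 1 - a^-1.
      by rewrite subr_gt0 invf_lt1// ltrDl invr_gt0.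
    (* Multiplying by [1 - a^-1], which is the inverse of [M.+1], telescopes the geometric sum. *)
    rewrite -(ler_pM2l q1) -opprB mulNr -subrX1 opprB.
    have -> : (1 - a^-1) * M.+1%:R = 1.
      by rewrite /a -natr1; field; rewrite !gt_eqF// addr_gt0.
    by rewrite opprB lerBlDr lerDl exprn_ge0// invr_ge0 ltW.
apply: (@le_trans _ _ (\prod_(i < T) \sum_b w b)); last first.
  by rewrite prodr_const card_ord lerXn2r// ?nnegrE ?sumr_ge0// !mulr_ge0//
    expR_ge0.
rewrite bigA_distr_bigA/= -sum1_card natr_sum.
rewrite [leRHS](bigID (mem lattice))/= -[leLHS]addr0 lerD//.
  by apply: ler_sum => z; exact: w1.
by apply: sumr_ge0 => z _; exact: prodr_ge0.
Qed.

Definition lattice_val (b : bool * 'I_(M * T).+1) : R := (-1) ^+ b.1 * b.2%:R.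

(** Truncation towards zero never increases [|c i|], and a natural number is at most its square, so
    the l1 norm inherits the bound on the squares. *)
Lemma lattice_approx (c : 'I_T -> R) : \sum_i c i ^+ 2 <= (M * T)%:R ->
  exists2 z, z \in lattice & forall i, `|c i - lattice_val (z i)| <= 1.
Proof.
move=> cM; pose m i := Num.truncn `|c i|.
have mc i : (m i)%:R <= `|c i| < (m i).+1%:R by exact: truncn_itv.
have mM : (\sum_i m i <= M * T)%N.
  rewrite -(ler_nat R) (le_trans _ cM)// natr_sum ler_sum// => i _.
  apply: (@le_trans _ _ ((m i) ^ 2)%:R).
    by rewrite ler_nat; case: (m i) => // n; rewrite leq_pmull.
  rewrite natrX -(real_normK (num_real (c i))) lerXn2r ?nnegrE//.
  by case/andP: (mc i).
have mi i : (m i < (M * T).+1)%N.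
  by rewrite ltnS (leq_trans _ mM)// (bigD1 i)//= leq_addr.
exists [ffun i => (c i < 0, Ordinal (mi i))].
  by rewrite inE (eq_bigr m)// => i _; rewrite ffunE.
move=> i; rewrite ffunE /lattice_val/=.
rewrite {1}[c i]numEsign.
rewrite -mulrBr normrM normrX normrN1 expr1n mul1r.
have /andP[m1 m2] := mc i.
by rewrite ger0_norm ?subr_ge0// lerBlDr (le_trans (ltW m2))// -natr1 addrC.
Qed.

End Counting.

(** * From the regret guarantee to a covering of the ball *)

Section Covering.
Context {R : realType} {E : topologicalType}.
Context (k : E -> E -> R) (H : set (E -> R)).
Context (ip : (E -> R) -> (E -> R) -> R) (hH : is_rkhs k H ip).
Context (X : set E).
Context (kc : continuous (fun p : E * E => k p.1 p.2)).
Context (k1 : forall x, X x -> k x x <= 1).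

Lemma vanish_bound (A : @algorithm R E X) (r eps : R) (T : nat) :
  0 <= r -> (0 < T)%N ->
  (forall f, rkhs_ball H ip r f -> simple_regret A f T <= eps) ->
  forall f, rkhs_ball H ip r f ->
    (forall i, (i < T)%N -> f (query A 0 i) = 0) ->
    forall x, X x -> `|f x| <= eps.
Proof.
move=> r0 T0 hA f /(rkhs_ballP hH _ r0)[Hf fr] f0 x Xx.
(* Stated for a general [g], to be applied to both [f] and [- f]. *)
have lower g : H g -> ip g g <= r ^+ 2 ->
    (forall i, (i < T)%N -> g (query A 0 i) = 0) -> - eps <= g x.
  move=> Hg gr g0; apply: (@simple_regret_vanish _ _ _ A g T x r) => //.
    move=> y Xy; have := rkhs_eval_abs_le hH r0 (k1 Xy) Hg gr.
    by rewrite ler_norml => /andP[].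
  by apply: hA; apply/(rkhs_ballP hH).
rewrite ler_norml (lower f)//= -lerN2; apply: (lower (- f)).
- exact: (rkhsN hH).
- rewrite -scaleN1r (ipZl hH)// ?(ipZr hH)//; last exact: (rkhsZ hH).
  by rewrite !mulN1r opprK.
- by move=> i iT; rewrite -[LHS]/(- f _) f0 ?oppr0.
Qed.

Lemma sup_norm_sigL_le (f g : E -> R) (a : R) : X !=set0 ->
  (forall x, X x -> `|f x - g x| <= a) ->
  sup_norm (sigL X f - sigL X g : X -> R) <= a.
Proof.
move=> [x Xx] fg; apply: ge_sup.
  by exists `|(sigL X f - sigL X g : X -> R) (SigSub (mem_set Xx))|; eexists.
by move=> _ [y _ <-]; apply: fg; exact: set_valP.
Qed.

Lemma covering_number_le (n : nat) (c : nat -> E -> R) (Q : set (E -> R))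
    (a : R) : X !=set0 -> (forall f, Q f -> continuous f) ->
  (forall j, continuous (c j)) ->
  (forall f, Q f -> exists2 j, (j < n)%N &
    forall x, X x -> `|f x - c j x| <= a) ->
  (unif_covering_number X Q a <= (n%:R)%:E)%E.
Proof.
move=> X0 Qc cc cover; pose C := [set sigL X (c j) | j in `I_n].
(* Distinct centres may have equal restrictions to [X], so [N] can be smaller than [n]. *)
have [N CN] : exists N, (C #= `I_N)%card.
  by apply/finite_setP/finite_image/finite_II.
apply: (@le_trans _ _ (N%:R)%:E).
  apply: ereal_inf_lbound; exists N => //; exists C => //; split.
    move=> _ [j _ <-]; apply/subspace_sigL_continuousP.
    exact: continuous_subspaceT.
  move=> _ [f Qf <-]; have [j jn fj] := cover _ Qf.
  exists (sigL X (c j)); first by exists j.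
  split; last exact: sup_norm_sigL_le.
  by apply/subspace_sigL_continuousP/continuous_subspaceT/Qc.
rewrite lee_fin ler_nat -card_le_II -(card_le_eql CN).
exact: card_image_le.
Qed.

Lemma unif_covering_ball_le (T M : nat) (e : 'I_T -> E -> R) (r eps a : R) :
  orthosystem H ip e -> X !=set0 -> 0 < eps -> 0 <= r -> eps + eps <= a ->
  (0 < T)%N -> (0 < M)%N -> (r / eps) ^+ 2 <= M%:R ->
  (forall f, rkhs_ball H ip r f -> (forall i, ip f (e i) = 0) ->
    forall x, X x -> `|f x| <= eps) ->
  (unif_covering_number X (rkhs_ball H ip r) a <=
    ((2 * expR 1 * M.+1%:R) ^+ T)%:E)%E.
Proof.
move=> he X0 eps0 r0 epsa T0 M0 rM evan.
case: (he) => He _ _.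
(* Mesh for which [T] coordinate errors of at most [delta] add up to at most [eps] in norm. *)
pose delta := eps / Num.sqrt T%:R.
have sT0 : 0 < Num.sqrt T%:R :> R by rewrite sqrtr_gt0 ltr0n.
have delta0 : 0 < delta by rewrite divr_gt0.
have delta2 : delta ^+ 2 * T%:R = eps ^+ 2.
  by rewrite expr_div_n sqr_sqrtr ?ler0n// divfK// gt_eqF// ltr0n.
pose z0 : {ffun 'I_T -> bool * 'I_(M * T).+1} := [ffun=> (false, ord0)].
pose F (z : {ffun 'I_T -> bool * 'I_(M * T).+1}) : E -> R :=
  \sum_i (delta * lattice_val (z i)) *: e i.
have HF z : H (F z) by exact: (rkhs_comb hH he).
apply: (@le_trans _ _ (#|lattice T M|%:R)%:E); last first.
  by rewrite lee_fin card_lattice_le.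
apply: (@covering_number_le _
  (fun j => F (nth z0 (enum (lattice T M)) j))) => //.
- by move=> f [Hf _]; exact: (rkhs_continuous hH kc).
- by move=> j; exact: (rkhs_continuous hH kc).
move=> f /(rkhs_ballP hH _ r0)[Hf fr].
have HP : H (orthoproj ip e f) by exact: (rkhs_comb hH he).
have pyth := orthoproj_pythagoras hH he Hf.
have [|z zL cz] := @lattice_approx R T M (fun i => ip f (e i) / delta).
  under eq_bigr do rewrite expr_div_n.
  rewrite -mulr_suml ler_pdivrMr ?exprn_gt0//.
  rewrite natrM -mulrA (mulrC T%:R) delta2.
  rewrite -ler_pdivrMr ?exprn_gt0// (le_trans _ rM)// expr_div_n.
  rewrite ler_pM2r ?invr_gt0 ?exprn_gt0// (le_trans _ fr)// pyth lerDr.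
  by rewrite (ip_ge0 hH)//; exact: (rkhsB hH).
have zE : z \in enum (lattice T M) by rewrite mem_enum.
exists (index z (enum (lattice T M))); first by rewrite cardE index_mem.
rewrite nth_index// => x Xx.
(* The residual costs [eps] by [evan], the rounding of the projection another [eps]. *)
have -> : f x - F z x = (f - orthoproj ip e f) x + (orthoproj ip e f - F z) x.
  by rewrite -[RHS]/(f x - _ + (_ - F z x)) addrA subrK.
rewrite (le_trans (ler_normD _ _))// (le_trans _ epsa)// lerD//.
- apply: evan => //; last by move=> i; exact: (orthoproj_residual hH he).
  apply/(rkhs_ballP hH _ r0); split; first exact: (rkhsB hH).
  by rewrite (le_trans _ fr)// pyth lerDl sumr_ge0// => i _; exact: sqr_ge0.
- apply: (rkhs_eval_abs_le hH (ltW eps0) (k1 Xx)); first exact: (rkhsB hH).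
  have -> : orthoproj ip e f - F z =
      \sum_i (ip f (e i) - delta * lattice_val (z i)) *: e i.
    by rewrite -sumrB; apply: eq_bigr => i _; rewrite scalerBl.
  apply: (le_trans (ip_comb_le hH he _)).
  rewrite -delta2 -[T in T%:R]card_ord mulr_natr -sumr_const ler_sum// => i _.
  rewrite -real_normK ?num_real// lerXn2r ?nnegrE ?(ltW delta0)//.
  have -> : ip f (e i) - delta * lattice_val (z i) =
      delta * (ip f (e i) / delta - lattice_val (z i)).
    by field; rewrite gt_eqF.
  by rewrite normrM gtr0_norm// ler_piMr ?(ltW delta0).
Qed.

End Covering.

(** * Constants and the final lower bound on [T] *)

Lemma covering_number_ge0 (R : realType) (F : zmodType) (V : set F)
  (nrm : F -> R) (G : set F) (e : R) : (0 <= covering_number V nrm G e)%E.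
Proof. by apply: le_ereal_inf_tmp => _ [N _ <-]; rewrite lee_fin. Qed.

Theorem theorem5p1 (R : realType) (d : nat)
    (k : 'rV[R]_d -> 'rV[R]_d -> R)
    (H : set ('rV[R]_d -> R)) (ip : ('rV[R]_d -> R) -> ('rV[R]_d -> R) -> R)
    (X : set 'rV[R]_d)
    (hk : psd_kernel k) (hH : is_rkhs k H ip) (hX : compact X)
    (hkc : continuous (fun p : 'rV[R]_d * 'rV[R]_d => k p.1 p.2))
    (hk1 : forall x1 x2, X x1 -> X x2 -> k x1 x2 <= 1) :
  exists c eta0 : R, [/\ 0 < c, 0 < eta0, eta0 < 1 &
    forall (r eps : R) (T : nat),
      0 < r -> 0 < eps -> eps / r < eta0 -> (0 < T)%N ->
      (exists A : @algorithm R 'rV[R]_d X,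
         forall f, rkhs_ball H ip r f -> simple_regret A f T <= eps) ->
      (c%:E * (lne (unif_covering_number X (rkhs_ball H ip r) (4 * eps))
               / (ln (r / eps))%:E) <= (T%:R)%:E)%E].
Proof.
have e2 : 2 <= expR 1 :> R by have := expR_ge1Dx (1 : R); rewrite -natr1.
have k1 x : X x -> k x x <= 1 by move=> Xx; exact: hk1.
(* The threshold forces [rho > 2 * expR 1 >= 4]: one factor [rho] absorbs [2 * expR 1] and three
   absorb [M.+1], whence the exponent [4 * T] and the constant [4^-1]. *)
exists 4^-1, (2 * expR 1)^-1; split => //.
  by rewrite invf_lt1 ?mulr_gt0 ?expR_gt0//; lra.
move=> r eps T r0 eps0 epsr T0 [A hA].
set rho := r / eps.
have rhoe : 2 * expR 1 < rho.
  rewrite -[2 * _]invrK /rho -[r / eps]invf_div ltf_pV2// posrE;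
    by rewrite ?divr_gt0// invr_gt0 mulr_gt0 ?expR_gt0.
pose M := (Num.truncn (rho ^+ 2)).+1.
have rho0 : 0 < rho by lra.
have /andP[M1 M2] : M.-1%:R <= rho ^+ 2 < M%:R.
  by apply: truncn_itv; exact: sqr_ge0.
have HA i : H (k (query A 0 i)) by exact: rkhs_kernel hH _.
have [e he espan] := gram_schmidt hH T HA.
have X0 : X !=set0 by exists (query A 0 0); exact: set_valP.
have evan f : rkhs_ball H ip r f -> (forall i, ip f (e i) = 0) ->
    forall x, X x -> `|f x| <= eps.
  move=> Sf fe; apply: (vanish_bound hH k1 (ltW r0) T0 hA Sf) => i iT.
  case: Sf => Hf _; rewrite (rkhs_reproducing hH _ Hf); exact: espan.
have cov : (unif_covering_number X (rkhs_ball H ip r) (4 * eps) <=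
    (rho ^+ (4 * T))%:E)%E.
  (* The covering constructed has radius [eps + eps], within the radius [4 * eps]. *)
  apply: le_trans (@unif_covering_ball_le _ _ _ _ _ hH _ hkc k1 T M e r eps _
    he X0 eps0 (ltW r0) _ T0 isT (ltW M2) evan) _; first lra.
  rewrite lee_fin exprM; apply: lerXn2r; rewrite ?nnegrE.
  - by rewrite !mulr_ge0 ?expR_ge0.
  - by rewrite exprn_ge0 ?ltW.
  have MS : M.+1%:R <= rho ^+ 2 + 2.
    have MM : M%:R = M.-1%:R + 1 :> R by rewrite natr1.
    by rewrite -natr1 MM; lra.
  have rho2 : rho ^+ 2 + 2 <= rho ^+ 3 by nra.
  rewrite [leRHS]exprS.
  apply: ler_pM; [by rewrite mulr_ge0 ?expR_ge0|by []|exact: ltW|].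
  exact: le_trans MS rho2.
have lrho : 0 < ln rho by rewrite ln_gt0//; lra.
have lcov : (lne (unif_covering_number X (rkhs_ball H ip r) (4 * eps)) <=
    ((4 * T)%:R * ln rho)%:E)%E.
  rewrite [_ * ln rho]mulr_natl -lnXn// -lne_EFin ?exprn_gt0//.
  by rewrite lee_lne// in_itv/= ?leey ?andbT ?covering_number_ge0// lee_fin
    exprn_ge0// ltW.
rewrite inver gt_eqF//.
apply: le_trans (lee_wpmul2l _ (lee_wpmul2r _ lcov)) _ => //.
  by rewrite lee_fin invr_ge0 ltW.
by rewrite -!EFinM lee_fin mulfK ?gt_eqF// natrM mulrA mulVf// mul1r.
Qed.
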